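(* Let $\lambda:A\times A\to(M,* )$ be a hermitian form. The quadratic form $(\lambda,\mu_\lambda):A\to\mathfrak M_\lambda$ is initial in the category of quadratic refinements of $\lambda$. In fact, the forgetful functor $R(\lambda,\mu)=\lambda$ from the category $\mathsf{QF}$ of (non-commutative) quadratic forms to the category $\mathsf{HF}$ of hermitian forms has a left adjoint $L:\mathsf{HF}\to\mathsf{QF}$ given by $L(\lambda)=(\lambda,\mu_\lambda)$.
   Context: A (non-commutative) quadratic group $\mathfrak M=(M_e\xrightarrow{h}M_{ee}\xrightarrow{p}M_e)$ consists of groups $M_e,M_{ee}$ (written additively) and homomorphisms $h,p$ such that $M_{ee}$ is abelian, the image of $p$ lies in the center of $M_e$, and $hph=2h$. A morphism $\beta:\mathfrak M\to\mathfrak M'$ is a pair of homomorphisms $\beta_e:M_e\to M'_e$, $\beta_{ee}:M_{ee}\to M'_{ee}$ commuting with $h,h'$ and $p,p'$. The endomorphism $*:=hp-\mathrm{id}$ is an involution on $M_{ee}$. A quadratic form $(\lambda,\mu):A\to\mathfrak M$ on an abelian group $A$ consists of a bilinear map $\lambda:A\times A\to M_{ee}$ and a map $\mu:A\to M_e$ with $\mu(a+a')=\mu(a)+\mu(a')+p(\lambda(a,a'))$ and $h(\mu(a))=\lambda(a,a)$ for all $a,a'\in A$ ($\mathfrak M$ is part of the data). Then $\lambda$ is hermitian with respect to $*=hp-\mathrm{id}$. Morphisms in $\mathsf{QF}$ are pairs $(\alpha:A\to A',\ \beta:\mathfrak M\to\mathfrak M')$ of morphisms with $\lambda'(\alpha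 a_1,\alpha a_2)=\beta_{ee}\lambda(a_1,a_2)$ and $\mu'(\alpha a)=\beta_e\mu(a)$. A hermitian form $\lambda:A\times A\to(M,* )$ is a bilinear map from an abelian group $A$ to an abelian group $M$ with involution $*$ such that $\lambda(a',a)=\lambda(a,a')^*$. Morphisms in $\mathsf{HF}$ are pairs $(\alpha:A\to A',\ \beta_{ee}:(M,* )\to(M',*'))$ of homomorphisms, $\beta_{ee}$ compatible with involutions, with $\lambda'(\alpha a_1,\alpha a_2)=\beta_{ee}\lambda(a_1,a_2)$. The functor $R$ forgets $\mu$, $M_e$ and $\beta_e$, and equips $M_{ee}$ with $*=hp-\mathrm{id}$. A quadratic refinement of $\lambda:A\times A\to(M,* )$ is a quadratic form $(\lambda,\mu):A\to\mathfrak M$ with $M_{ee}=M$ and $hp-\mathrm{id}=*$; morphisms of quadratic refinements of $\lambda$ are the morphisms in $\mathsf{QF}$ lying over the identity of $\lambda$. Given a hermitian form $\lambda:A\times A\to(M,* )$, $\mathfrak M_\lambda$ is the quadratic group with $M_{ee}=M$, $M_e=M\times_\lambda A$ the set of pairs $(m,a)$ with group law $(m,a)+(m',a')=(m+m'-\lambda(a,a'),a+a')$, $p_\lambda(m)=(m,0)$, $h_\lambda(m,a)=m+m^*+\lambda(a,a)$; and $\mu_\lambda(a)=(0,a)$. *)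

(* Defs.v *)
From HB Require Import structures.
From mathcomp Require Import all_boot all_algebra.
From mathcomp Require Import boolp.

Set Implicit Arguments.
Unset Strict Implicit.
Unset Printing Implicit Defensive.

Import GRing.Theory.
Local Open Scope ring_scope.
Local Obligation Tactic := idtac.

Record category := Category {
  obj :> Type;
  hom : obj -> obj -> Type;
  idc : forall x, hom x x;
  compc : forall x y z, hom y z -> hom x y -> hom x z;
  comp_idl : forall x y (f : hom x y), compc (idc y) f = f;
  comp_idr : forall x y (f : hom x y), compc f (idc x) = f;
  compcA : forall x y z t (f : hom z t) (g : hom y z) (k : hom x y),
    compc f (compc g k) = compc (compc f g) k }.

Record functor (C D : category) := Functor {
  fobj :> C -> D;
  fmap : forall x y : C, hom x y -> hom (fobj x) (fobj y);
  fmap_id : forall x, fmap (idc x) = idc (fobj x);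
  fmap_comp : forall x y z (f : hom y z) (g : hom x y),
    fmap (compc f g) = compc (fmap f) (fmap g) }.

Definition initial (C : category) (x : C) : Prop :=
  forall y : C, exists f : hom x y, forall g : hom x y, g = f.

Definition left_adjoint (C D : category) (L : functor C D) (R : functor D C) :
    Prop :=
  exists phi : forall (x : C) (y : D), hom (L x) y -> hom x (R y),
    (forall x y, bijective (@phi x y)) /\
    (forall (x x' : C) (y y' : D) (f : hom x' x) (g : hom (L x) y)
        (k : hom y y'),
      phi x' y' (compc k (compc g (fmap L f))) =
      compc (fmap R k) (compc (phi x y g) f)).

Definition biadditive (A M : zmodType) (lam : A -> A -> M) : Prop :=
  (forall a, {morph lam a : x y / x + y}) /\
  (forall a, {morph lam^~ a : x y / x + y}).

(* Library groups that need not be abelian are multiplicative: the group law of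
   M_e, written additively in the literature, is [_ * _]%g here. *)
Record quad_group (Mee : zmodType) := QuadGroup {
  qg_e : groupType;
  qg_h : qg_e -> Mee;
  qg_p : Mee -> qg_e;
  qg_hD : {morph qg_h : x y / (x * y)%g >-> x + y};
  qg_pD : {morph qg_p : m n / m + n >-> (m * n)%g};
  qg_p_central : forall m x, (qg_p m * x)%g = (x * qg_p m)%g;
  qg_hph : forall x, qg_h (qg_p (qg_h x)) = qg_h x *+ 2 }.

Definition qg_star (Mee : zmodType) (Q : quad_group Mee) (m : Mee) : Mee :=
  qg_h (qg_p Q m) - m.

Record quad_group_hom (Mee Mee' : zmodType) (Q : quad_group Mee)
    (Q' : quad_group Mee') := QuadGroupHom {
  qgh_e : {multiplicative qg_e Q -> qg_e Q'};
  qgh_ee : {additive Mee -> Mee'};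
  qgh_h : forall x, qg_h (qgh_e x) = qgh_ee (qg_h x);
  qgh_p : forall m, qg_p Q' (qgh_ee m) = qgh_e (qg_p Q m) }.

Definition is_quadratic_form (A Mee : zmodType) (Q : quad_group Mee)
    (lam : A -> A -> Mee) (mu : A -> qg_e Q) : Prop :=
  [/\ biadditive lam,
      forall a a', mu (a + a') = (mu a * mu a' * qg_p Q (lam a a'))%g
    & forall a, qg_h (mu a) = lam a a].

Record quadratic_form := QuadraticForm {
  qf_A : zmodType;
  qf_ee : zmodType;
  qf_M : quad_group qf_ee;
  qf_lam : qf_A -> qf_A -> qf_ee;
  qf_mu : qf_A -> qg_e qf_M;
  qfP : is_quadratic_form qf_lam qf_mu }.

Record qf_hom (x y : quadratic_form) := QFHom {
  qfh_A : {additive qf_A x -> qf_A y};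
  qfh_M : quad_group_hom (qf_M x) (qf_M y);
  qfh_lam : forall a b,
    qf_lam (qfh_A a) (qfh_A b) = qgh_ee qfh_M (qf_lam a b);
  qfh_mu : forall a, qf_mu (qfh_A a) = qgh_e qfh_M (qf_mu a) }.

Record hermitian_form := HermitianForm {
  hf_A : zmodType;
  hf_M : zmodType;
  hf_star : {additive hf_M -> hf_M};
  hf_lam : hf_A -> hf_A -> hf_M;
  hf_starK : involutive hf_star;
  hf_biadd : biadditive hf_lam;
  hf_sym : forall a a', hf_lam a' a = hf_star (hf_lam a a') }.

Record hf_hom (x y : hermitian_form) := HFHom {
  hfh_A : {additive hf_A x -> hf_A y};
  hfh_M : {additive hf_M x -> hf_M y};
  hfh_star : forall m, hfh_M (hf_star x m) = hf_star y (hfh_M m);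
  hfh_lam : forall a b, hf_lam (hfh_A a) (hfh_A b) = hfh_M (hf_lam a b) }.

Lemma additive_ext (U V : zmodType) (f g : {additive U -> V}) :
  f =1 g -> f = g.
Proof.
case: f g => [f [[cf]]] [g [[cg]]] /= /funext fg; case: g / fg cg => cg.
by rewrite (Prop_irrelevance cf cg).
Qed.

Lemma multiplicative_ext (U V : groupType) (f g : {multiplicative U -> V}) :
  f =1 g -> f = g.
Proof.
case: f g => [f [[cf]]] [g [[cg]]] /= /funext fg; case: g / fg cg => cg.
by rewrite (Prop_irrelevance cf cg).
Qed.

Lemma qf_hom_ext x y (f g : qf_hom x y) :
  qfh_A f =1 qfh_A g -> qgh_e (qfh_M f) =1 qgh_e (qfh_M g) ->
  qgh_ee (qfh_M f) =1 qgh_ee (qfh_M g) -> f = g.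
Proof.
case: f g => [fA [fe fm fh fp] fl fmu] [gA [ge gm gh gp] gl gmu] /=.
move=> /additive_ext eA /multiplicative_ext ee /additive_ext em; subst.
have eh : fh = gh by exact: Prop_irrelevance.
have ep : fp = gp by exact: Prop_irrelevance.
subst; congr QFHom; exact: Prop_irrelevance.
Qed.

Lemma hf_hom_ext x y (f g : hf_hom x y) :
  hfh_A f =1 hfh_A g -> hfh_M f =1 hfh_M g -> f = g.
Proof.
case: f g => [fA fm fs fl] [gA gm gs gl] /= /additive_ext eA /additive_ext em.
subst; congr HFHom; exact: Prop_irrelevance.
Qed.

Definition qf_id (x : quadratic_form) : qf_hom x x :=
  @QFHom x x idfun
    (@QuadGroupHom _ _ (qf_M x) (qf_M x) idfun idfun
       (fun=> erefl) (fun=> erefl))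
    (fun _ _ => erefl) (fun=> erefl).

Section QFComp.
Variables (x y z : quadratic_form) (f : qf_hom y z) (g : qf_hom x y).

Let e : {multiplicative qg_e (qf_M x) -> qg_e (qf_M z)} :=
  qgh_e (qfh_M f) \o qgh_e (qfh_M g).
Let ee : {additive qf_ee x -> qf_ee z} := qgh_ee (qfh_M f) \o qgh_ee (qfh_M g).
Let al : {additive qf_A x -> qf_A z} := qfh_A f \o qfh_A g.

Fact qf_comp_h u : qg_h (e u) = ee (qg_h u).
Proof. by rewrite /= !qgh_h. Qed.

Fact qf_comp_p m : qg_p (qf_M z) (ee m) = e (qg_p (qf_M x) m).
Proof. by rewrite /= !qgh_p. Qed.

Fact qf_comp_lam a b : qf_lam (al a) (al b) = ee (qf_lam a b).
Proof. by rewrite /= !qfh_lam. Qed.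

Fact qf_comp_mu a : qf_mu (al a) = e (qf_mu a).
Proof. by rewrite /= !qfh_mu. Qed.

Definition qf_comp : qf_hom x z :=
  @QFHom x z al (QuadGroupHom qf_comp_h qf_comp_p) qf_comp_lam qf_comp_mu.
End QFComp.

Program Definition QF : category :=
  @Category quadratic_form qf_hom qf_id qf_comp _ _ _.
Next Obligation. by move=> x y f; apply: qf_hom_ext. Qed.
Next Obligation. by move=> x y f; apply: qf_hom_ext. Qed.
Next Obligation. by move=> x y z t f g k; apply: qf_hom_ext. Qed.

Definition hf_id (x : hermitian_form) : hf_hom x x :=
  @HFHom x x idfun idfun (fun=> erefl) (fun _ _ => erefl).

Section HFComp.
Variables (x y z : hermitian_form) (f : hf_hom y z) (g : hf_hom x y).

Let ee : {additive hf_M x -> hf_M z} := hfh_M f \o hfh_M g.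
Let al : {additive hf_A x -> hf_A z} := hfh_A f \o hfh_A g.

Fact hf_comp_star m : ee (hf_star x m) = hf_star z (ee m).
Proof. by rewrite /= !hfh_star. Qed.

Fact hf_comp_lam a b : hf_lam (al a) (al b) = ee (hf_lam a b).
Proof. by rewrite /= !hfh_lam. Qed.

Definition hf_comp : hf_hom x z := @HFHom x z al ee hf_comp_star hf_comp_lam.
End HFComp.

Program Definition HF : category :=
  @Category hermitian_form hf_hom hf_id hf_comp _ _ _.
Next Obligation. by move=> x y f; apply: hf_hom_ext. Qed.
Next Obligation. by move=> x y f; apply: hf_hom_ext. Qed.
Next Obligation. by move=> x y z t f g k; apply: hf_hom_ext. Qed.

Section Forget.
Variables (Mee : zmodType) (Q : quad_group Mee).

Fact qg_star_zmod_morphism : zmod_morphism (qg_star Q).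
Proof.
have hp_morph : zmod_morphism (fun m => qg_h (qg_p Q m)).
  move=> m n; apply/eqP; rewrite eq_sym subr_eq; apply/eqP.
  by rewrite -qg_hD -qg_pD subrK.
by move=> m n; rewrite /qg_star hp_morph !opprB [n - m]addrC addrACA
  [- _ + n]addrC.
Qed.

HB.instance Definition _ :=
  GRing.isZmodMorphism.Build Mee Mee (qg_star Q) qg_star_zmod_morphism.

Fact qg_starK : involutive (qg_star Q).
Proof.
move=> m; rewrite {1}/qg_star.
have -> : qg_h (qg_p Q (qg_star Q m)) = qg_h (qg_p Q m).
  apply: (addIr (qg_h (qg_p Q m))).
  by rewrite -qg_hD -qg_pD subrK qg_hph mulr2n.
by rewrite opprB addrC subrK.
Qed.
End Forget.

Fact qf_lam_sym (x : quadratic_form) (a a' : qf_A x) :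
  qf_lam a' a = qg_star (qf_M x) (qf_lam a a').
Proof.
case: (qfP x) => -[lamDr lamDl] muD hmu.
have := hmu (a + a'); rewrite muD !qg_hD !hmu lamDr !lamDl /qg_star => e.
apply/eqP; rewrite eq_sym subr_eq; apply/eqP.
apply: (addrI (qf_lam a a + qf_lam a' a')); rewrite e.
by rewrite [qf_lam a a' + _]addrC addrACA.
Qed.

Fact qf_biadd (x : quadratic_form) : biadditive (@qf_lam x).
Proof. by case: (qfP x). Qed.

Definition forget_obj (x : quadratic_form) : hermitian_form :=
  @HermitianForm (qf_A x) (qf_ee x) (qg_star (qf_M x)) (@qf_lam x)
    (@qg_starK _ (qf_M x)) (@qf_biadd x) (@qf_lam_sym x).

Fact forget_star x y (f : qf_hom x y) m :
  qgh_ee (qfh_M f) (qg_star (qf_M x) m) =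
  qg_star (qf_M y) (qgh_ee (qfh_M f) m).
Proof. by rewrite /qg_star raddfB /= qgh_p qgh_h. Qed.

Definition forget_hom x y (f : qf_hom x y) :
    hf_hom (forget_obj x) (forget_obj y) :=
  @HFHom (forget_obj x) (forget_obj y) (qfh_A f) (qgh_ee (qfh_M f))
    (@forget_star x y f) (@qfh_lam x y f).

Program Definition R : functor QF HF :=
  @Functor QF HF forget_obj forget_hom _ _.
Next Obligation. by move=> x; apply: hf_hom_ext. Qed.
Next Obligation. by move=> x y z f g; apply: hf_hom_ext. Qed.

Record refinement (lam : hermitian_form) := Refinement {
  rf_M : quad_group (hf_M lam);
  rf_mu : hf_A lam -> qg_e rf_M;
  rf_star : forall m, qg_star rf_M m = hf_star lam m;
  rfP : is_quadratic_form (@hf_lam lam) rf_mu }.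

Definition refinement_qf lam (x : refinement lam) : quadratic_form :=
  QuadraticForm (rfP x).

(* [f] lies over the identity of [lam]: both components of [fmap R f] are
   identity maps. *)
Definition over_id lam (x y : refinement lam)
    (f : qf_hom (refinement_qf x) (refinement_qf y)) : Prop :=
  (forall a : hf_A lam, qfh_A f a = a) /\
  (forall m : hf_M lam, qgh_ee (qfh_M f) m = m).

Definition refinement_hom lam (x y : refinement lam) : Type :=
  {f : qf_hom (refinement_qf x) (refinement_qf y) | over_id f}.

Lemma refinement_hom_ext lam (x y : refinement lam) (f g : refinement_hom x y) :
  sval f = sval g -> f = g.
Proof.
case: f g => [f pf] [g pg] /= fg; subst.
by rewrite (Prop_irrelevance pf pg).
Qed.

Fact over_id_id lam (x : refinement lam) : over_id (qf_id (refinement_qf x)).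
Proof. by []. Qed.

Fact over_id_comp lam (x y z : refinement lam)
    (f : refinement_hom y z) (g : refinement_hom x y) :
  over_id (qf_comp (sval f) (sval g)).
Proof.
case: f g => [f [fA fM]] [g [gA gM]]; split=> [a|m] /=.
  by rewrite gA fA.
by rewrite gM fM.
Qed.

Program Definition Refinements (lam : hermitian_form) : category :=
  @Category (refinement lam) (@refinement_hom lam)
    (fun x => exist _ (qf_id (refinement_qf x)) (over_id_id x))
    (fun x y z f g => exist _ (qf_comp (sval f) (sval g)) (over_id_comp f g))
    _ _ _.
Next Obligation.
by move=> lam x y f; apply/refinement_hom_ext/(@comp_idl QF).
Qed.
Next Obligation.
by move=> lam x y f; apply/refinement_hom_ext/(@comp_idr QF).
Qed.
Next Obligation.
by move=> lam x y z t f g k; apply/refinement_hom_ext/(@compcA QF).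
Qed.

(* The set of pairs underlying M x_lam A, as a distinct type so that it does not
   pick up the structure of the direct product. *)
Definition twisted (lam : hermitian_form) : Type := (hf_M lam * hf_A lam)%type.

Section Twisted.
Variable lam : hermitian_form.
Local Notation M := (hf_M lam).
Local Notation A := (hf_A lam).
Local Notation l := (@hf_lam lam).
Local Notation star := (hf_star lam).

HB.instance Definition _ := Choice.copy (twisted lam) (M * A)%type.

Definition tw_one : twisted lam := (0, 0).
Definition tw_mul (u v : twisted lam) : twisted lam :=
  (u.1 + v.1 - l u.2 v.2, u.2 + v.2).
Definition tw_inv (u : twisted lam) : twisted lam :=
  (- u.1 - l u.2 u.2, - u.2).

Fact lamDr (a b c : A) : l a (b + c) = l a b + l a c.
Proof. by case: (hf_biadd lam) => + _; apply. Qed.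
Fact lamDl (a b c : A) : l (a + b) c = l a c + l b c.
Proof. by case: (hf_biadd lam) => _; apply. Qed.
Fact lam0r (a : A) : l a 0 = 0.
Proof. by apply: (addrI (l a 0)); rewrite -lamDr !addr0. Qed.
Fact lam0l (a : A) : l 0 a = 0.
Proof. by apply: (addrI (l 0 a)); rewrite -lamDl !addr0. Qed.
Fact lamNr (a b : A) : l a (- b) = - l a b.
Proof. by apply: (addrI (l a b)); rewrite -lamDr !subrr lam0r. Qed.
Fact lamNl (a b : A) : l (- a) b = - l a b.
Proof. by apply: (addrI (l a b)); rewrite -lamDl !subrr lam0l. Qed.

Fact tw_mulA : associative tw_mul.
Proof.
move=> [m a] [n b] [o c]; rewrite /tw_mul /= lamDr lamDl addrA.
congr (_, _); last exact: addrA.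
rewrite [m + n - _ + o]addrAC -[m + n + o]addrA -!addrA -!opprD.
by congr (_ + (_ + (_ - _))); rewrite addrC -addrA.
Qed.
Fact tw_mul1 : left_id tw_one tw_mul.
Proof. by move=> [m a]; rewrite /tw_mul /= lam0l !add0r subr0. Qed.
Fact tw_mulr1 : right_id tw_one tw_mul.
Proof. by move=> [m a]; rewrite /tw_mul /= lam0r !addr0 subr0. Qed.
Fact tw_mulV : left_inverse tw_one tw_inv tw_mul.
Proof.
move=> [m a]; rewrite /tw_mul /tw_inv /= lamNl opprK addNr.
by rewrite addrAC subrK addNr.
Qed.
Fact tw_mulrV : right_inverse tw_one tw_inv tw_mul.
Proof.
move=> [m a]; rewrite /tw_mul /tw_inv /= lamNr opprK subrr.
by rewrite addrA subrK subrr.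
Qed.

HB.instance Definition _ := isGroup.Build (twisted lam)
  tw_mulA tw_mul1 tw_mulr1 tw_mulV tw_mulrV.

Definition tw_p (m : M) : twisted lam := (m, 0).
Definition tw_h (u : twisted lam) : M := u.1 + star u.1 + l u.2 u.2.
Definition tw_mu (a : A) : twisted lam := (0, a).

Fact tw_hD : {morph tw_h : u v / (u * v)%g >-> u + v}.
Proof.
move=> [m a] [n b].
rewrite /tw_h /= raddfB raddfD /= -hf_sym lamDr !lamDl.
set x := l a b; set y := l b a; set s := star m; set t := star n.
set aa := l a a; set bb := l b b.
rewrite [m + n - x + _]addrACA -[m + n + _]addrACA -[- x - y]opprD.
have -> : aa + y + (x + bb) = x + y + (aa + bb).
  by rewrite [aa + y]addrC addrACA [y + x]addrC.
by rewrite [LHS]addrA subrK [RHS]addrACA.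
Qed.
Fact tw_pD : {morph tw_p : m n / m + n >-> (m * n)%g}.
Proof. by move=> m n; congr (_, _); rewrite /= ?lam0r ?subr0 ?addr0. Qed.
Fact tw_p_central m u : (tw_p m * u)%g = (u * tw_p m)%g.
Proof.
by congr (_, _); rewrite /= ?lam0r ?lam0l ?[m + _]addrC // add0r addr0.
Qed.
Fact tw_hph u : tw_h (tw_p (tw_h u)) = tw_h u *+ 2.
Proof.
rewrite [LHS]/tw_h /= lam0r addr0 mulr2n; congr (_ + _).
by rewrite /tw_h !raddfD /= hf_starK -hf_sym [star _ + _]addrC.
Qed.

Definition M_lam : quad_group M := QuadGroup tw_hD tw_pD tw_p_central tw_hph.

Fact M_lam_star m : qg_star M_lam m = star m.
Proof. by rewrite /qg_star /= /tw_h /= lam0r addr0 addrC addKr. Qed.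

Fact mu_lamP : @is_quadratic_form A M M_lam l tw_mu.
Proof.
split; first exact: hf_biadd.
  move=> a b; congr (_, _); rewrite /= ?addr0 //.
  by rewrite lam0r subr0 add0r addNr.
by move=> a; rewrite /= /tw_h /= raddf0 !add0r.
Qed.

Definition mu_lam : refinement lam :=
  @Refinement lam M_lam tw_mu M_lam_star mu_lamP.
End Twisted.

Definition L_obj (lam : hermitian_form) : quadratic_form :=
  refinement_qf (mu_lam lam).

Section LHom.
Variables (x y : hermitian_form) (f : hf_hom x y).

Definition L_e (u : twisted x) : twisted y := (hfh_M f u.1, hfh_A f u.2).

Fact L_eM : {morph L_e : u v / (u * v)%g}.
Proof.
by move=> u v; congr (_, _); rewrite /= ?raddfB !raddfD //= hfh_lam.
Qed.

HB.instance Definition _ :=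
  isMultiplicative.Build (twisted x) (twisted y) L_e L_eM.

Fact L_h u : tw_h (L_e u) = hfh_M f (tw_h u).
Proof. by rewrite /tw_h /= !raddfD /= hfh_star hfh_lam. Qed.

Fact L_p m : tw_p (hfh_M f m) = L_e (tw_p m).
Proof. by rewrite /L_e /= raddf0. Qed.

Fact L_mu a : tw_mu (hfh_A f a) = L_e (tw_mu a).
Proof. by rewrite /L_e /= raddf0. Qed.

Definition L_hom : qf_hom (L_obj x) (L_obj y) :=
  @QFHom (L_obj x) (L_obj y) (hfh_A f)
    (@QuadGroupHom _ _ (M_lam x) (M_lam y) L_e (hfh_M f) L_h L_p)
    (@hfh_lam x y f) L_mu.
End LHom.

Program Definition L : functor HF QF := @Functor HF QF L_obj L_hom _ _.
Next Obligation. by move=> x; apply: qf_hom_ext => // -[]. Qed.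
Next Obligation. by move=> x y z f g; apply: qf_hom_ext. Qed.

(* Main.v *)
Require Import Defs.
From HB Require Import structures.
From mathcomp Require Import all_boot all_algebra.

Set Implicit Arguments.
Unset Strict Implicit.
Unset Printing Implicit Defensive.

Import GRing.Theory.
Local Open Scope ring_scope.

(** In [M_lam lam] every element factors as [(m, a) = p m * mu a], so a morphism
    out of [L lam] is determined on [M_e] by its components on [A] and [M_ee]
    ([qf_hom_L_ext]).  Conversely, a morphism [f] of hermitian forms from [lam]
    to the form underlying a quadratic form [y] forces the formula
    [(m, a) |-> p (f m) * mu (f a)] on [M_e].  This is a homomorphism because
    the correction term [- lam a b] in the group law of [M_lam lam] cancels the
    deviation [p (lam a b)] of [mu] from additivity, the image of [p] being
    central; it commutes with [h] because [h (p m) = m + star m] and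
    [h (mu a) = lam a a].  So restricting along the unit [lam -> R (L lam)],
    the identity on [A] and [M], is a bijection
    [hom (L lam) y -> hom lam (R y)], which is the adjunction.

    Initiality of [mu_lam lam] is the part of this bijection over the identity
    of [lam]: a refinement [y] of [lam] has an identity morphism from [lam] to
    [R y], whose transpose is the unique morphism of refinements
    [mu_lam lam -> y]. *)

Lemma qg_p0 (M : zmodType) (Q : quad_group M) : qg_p Q 0 = 1%g.
Proof. by apply: (mulgI (qg_p Q 0)); rewrite -qg_pD addr0 mulg1. Qed.

Lemma qf_mu0 (x : quadratic_form) : qf_mu (0 : qf_A x) = 1%g.
Proof.
case: (qfP x) => -[lamDr _] muD _.
have lam00 : qf_lam (0 : qf_A x) 0 = 0.
  by apply: (addrI (qf_lam (0 : qf_A x) 0)); rewrite -lamDr !addr0.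
apply: (mulgI (qf_mu (0 : qf_A x))).
by have := muD 0 0; rewrite addr0 lam00 qg_p0 !mulg1 => <-.
Qed.

Lemma twisted_split (lam : hermitian_form) (u : twisted lam) :
  u = (tw_p u.1 * tw_mu u.2)%g.
Proof.
by case: u => m a; congr (_, _); rewrite /= ?lam0l ?subr0 ?addr0 ?add0r.
Qed.

Section Transpose.
Variables (x : hermitian_form) (y : quadratic_form).

(** [twisted_split] carried along [g]: compatibility with [p] and [mu] pins down
    the image of each factor. *)
Lemma qgh_e_L (g : qf_hom (L_obj x) y) (u : twisted x) :
  qgh_e (qfh_M g) u =
  (qg_p (qf_M y) (qgh_ee (qfh_M g) u.1) * qf_mu (qfh_A g u.2))%g.
Proof.
by rewrite [in LHS](twisted_split u) gmulfM (qgh_p (qfh_M g)) (qfh_mu g).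
Qed.

(** The uniqueness half of both universal properties. *)
Lemma qf_hom_L_ext (f g : qf_hom (L_obj x) y) :
  qfh_A f =1 qfh_A g -> qgh_ee (qfh_M f) =1 qgh_ee (qfh_M g) -> f = g.
Proof.
by move=> eA eM; apply: qf_hom_ext => // u; rewrite !qgh_e_L eA eM.
Qed.

Variable f : hf_hom x (forget_obj y).

(** The only candidate, by [qgh_e_L], for the component on [M_e] of a morphism
    out of [L x] that restricts to [f]. *)
Definition transpose_e (u : twisted x) : qg_e (qf_M y) :=
  (qg_p (qf_M y) (hfh_M f u.1) * qf_mu (hfh_A f u.2))%g.

(** Additivity of [f] gives the left side the central factor [p (- l)], where
    [l] is the value of the form on the two images, while [mu] of a sum
    contributes [p l]; the two cancel. *)
Fact transpose_eM : {morph transpose_e : u v / (u * v)%g}.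
Proof.
move=> [m a] [n b]; rewrite /transpose_e /= raddfB !raddfD /= -hfh_lam /=.
case: (qfP y) => _ -> _.
set l := qf_lam _ _; set s := hfh_M f m; set t := hfh_M f n.
(* Move the factor [p l] coming from [mu] next to [p (s + t - l)]. *)
rewrite -qg_p_central mulgA -qg_pD subrK qg_pD -!mulgA; congr (_ * _)%g.
by rewrite !mulgA -qg_p_central.
Qed.

HB.instance Definition _ :=
  isMultiplicative.Build (twisted x) (qg_e (qf_M y)) transpose_e transpose_eM.

Fact transpose_h u : qg_h (transpose_e u) = hfh_M f (tw_h u).
Proof.
case: (qfP y) => _ _ hmu.
rewrite /transpose_e qg_hD hmu /tw_h !raddfD /= hfh_star -hfh_lam /=.
by rewrite /qg_star [_ + (_ - _)]addrC subrK.
Qed.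

Fact transpose_p m : qg_p (qf_M y) (hfh_M f m) = transpose_e (tw_p m).
Proof. by rewrite /transpose_e /= raddf0 qf_mu0 mulg1. Qed.

Fact transpose_mu a : qf_mu (hfh_A f a) = transpose_e (tw_mu a).
Proof. by rewrite /transpose_e /= raddf0 qg_p0 mul1g. Qed.

Definition transpose : qf_hom (L_obj x) y :=
  @QFHom (L_obj x) y (hfh_A f)
    (@QuadGroupHom _ _ (M_lam x) (qf_M y) transpose_e (hfh_M f)
       transpose_h transpose_p)
    (@hfh_lam x (forget_obj y) f) transpose_mu.
End Transpose.

(** The involution [hp - id] of [M_lam x] agrees with that of [x] only
    propositionally, so the unit is not literally [hf_id x]. *)
Definition unit_hom (x : hermitian_form) : hf_hom x (forget_obj (L_obj x)) :=
  @HFHom x (forget_obj (L_obj x)) idfun idfun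
    (fun m => esym (M_lam_star m)) (fun _ _ => erefl).

(** Naturality and both inverse laws hold because every morphism involved is
    determined by its components on [A] and [M_ee], and the unit and
    [transpose] leave those unchanged. *)
Lemma L_left_adjoint : left_adjoint L R.
Proof.
exists (fun x y g => hf_comp (forget_hom g) (unit_hom x)); split=> [x y|].
  exists (@transpose x y) => g; first exact: qf_hom_L_ext.
  exact: hf_hom_ext.
by move=> x x' y y' f g k; apply: hf_hom_ext.
Qed.

Lemma refinement_id_star (lam : hermitian_form) (y : refinement lam) m :
  hf_star lam m = hf_star (forget_obj (refinement_qf y)) m.
Proof. exact: esym (rf_star y m). Qed.

(** A refinement prescribes its involution only up to pointwise equality, so
    this is the identity of [lam] with its target replaced by an extensionally
    equal hermitian form. *)
Definition refinement_id (lam : hermitian_form) (y : refinement lam) :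
    hf_hom lam (forget_obj (refinement_qf y)) :=
  @HFHom lam (forget_obj (refinement_qf y)) idfun idfun
    (refinement_id_star y) (fun _ _ => erefl).

Lemma mu_lam_initial (lam : hermitian_form) :
  @initial (Refinements lam) (mu_lam lam).
Proof.
move=> y.
have over_idT : @over_id _ (mu_lam lam) y (transpose (refinement_id y)) by [].
exists (exist _ (transpose (refinement_id y)) over_idT) => -[g [gA gM]].
by apply: refinement_hom_ext; apply: qf_hom_L_ext.
Qed.

Theorem theorem32 :
  (forall lam : hermitian_form, @initial (Refinements lam) (mu_lam lam)) /\
  left_adjoint L R.
Proof. by split; [exact: mu_lam_initial | exact: L_left_adjoint]. Qed.
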